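(* Let $q \geq 5$ be an odd prime power, and let $G$ be a finite group with a minimal normal subgroup $N = \mathrm{PSL}_2(q)\times\cdots\times\mathrm{PSL}_2(q)$, a direct product of $k$ copies of $\mathrm{PSL}_2(q)$, such that $|G/N| \geq q^k$. Write $|G| = b(G)(b(G)+e)$. Then $e > \sqrt{b(G)}+1$, and in particular $|G| < e^4-e^3$.
   Context: $b(G)$ denotes the largest degree of a complex irreducible character of $G$. *)

(* Defs.v *)
From HB Require Import structures.
From mathcomp Require Import all_boot all_order all_algebra all_fingroup all_solvable all_field all_character.
Set Implicit Arguments. Unset Strict Implicit. Unset Printing Implicit Defensive.
Import Order.TTheory GRing.Theory Num.Theory.

(* SL_2(F) as a subgroup of GL_2(F) (the generated group of the set of
   determinant-one matrices, which is that set itself). *)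
Definition SL2_set (F : finFieldType) : {set {'GL_2[F]}} :=
  [set g : {'GL_2[F]} | (\det (GLval g) == 1)%R].
Definition SL2 (F : finFieldType) : {group {'GL_2[F]}} := <<SL2_set F>>%G.

Definition PSL2 (F : finFieldType) := (SL2 F / 'Z(SL2 F))%G.

Local Open Scope ring_scope.
Definition bmax (gT : finGroupType) (G : {group gT}) : algC :=
  \big[Num.max/0%R]_(i : Iirr G) ('chi[G]_i 1%g).

(* Main.v *)
(* Write m = |G : N| and let n = b(G) be attained over the G-orbit of theta in
   Irr(N).  By Clifford theory n^2 <= m S, where S is the sum of the squares of
   the degrees in that orbit.  Let St be the product of the Steinberg characters
   of the k factors, of degree q^k.  If theta is not conjugate to St, then
   S <= |N| - q^(2k).  Otherwise S <= (q (q + 1))^k: for P a Sylow p-subgroup of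
   N, every conjugate of St contains the trivial character of N_N(P) (all
   conjugates of P by G are conjugate in N), hence is a constituent of the
   permutation character of N on the (q + 1)^k cosets of N_N(P), so there are at
   most (1 + 1/q)^k of them.  In both cases the bound on n^2 gives
   |G| > n^2 + n^(3/2) + n, which is the claim. *)
Require Import Defs.
From HB Require Import structures.
From mathcomp Require Import all_boot all_order all_algebra all_fingroup all_solvable all_field all_character.
From mathcomp Require Import ring zify.
Import Order.TTheory GRing.Theory Num.Theory.

Set Implicit Arguments. Unset Strict Implicit. Unset Printing Implicit Defensive.

(** * Arithmetic *)

(* The conclusion is n^2 + n^(3/2) + n < g, written without square roots. *)
Lemma large_gap_of_half (n X g : nat) :
  n ^ 2 <= X -> 2 * X <= g -> 30 <= X ->
  n ^ 2 + n < g /\ n ^ 3 < (g - n - n ^ 2) ^ 2.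
Proof.
rewrite !expnS !expn0 !muln1 => nX Xg X30.
have nn : n <= n * n by nia.
(* Since 2X <= g, the gap is at least n^2 - n, whose square exceeds n^3 once n >= 3; smaller n are
   covered by [30 <= X]. *)
have [n3|n3] := leqP 3 n.
  have : n < n * n by nia.
  split; first lia.
  have : n * (n - 1) <= g - n - n * n by rewrite mulnBr muln1; lia.
  set z := g - _ - _ => zn.
  have : (n * (n - 1)) * (n * (n - 1)) <= z * z by apply: leq_mul.
  have : n * (n * n) < n * (n - 1) * (n * (n - 1)) by nia.
  lia.
have n2 : n <= 2 by [].
have n8 : n * (n * n) <= 8 by case: n n2 {n3 nX nn} => [|[|[|]]].
split; first nia.
have : 28 <= g - n - n * n by nia.
set z := g - _ - _; nia.
Qed.

(** Applied with m = |G : N|, r = q^k, M = |N|. Put x = m r^2. Then 2n^2 <= m r^3 yields 5n <= x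
    and, since r <= m, 2n^3 <= x^2. The gap is at least x - n >= 4x/5, and 16x^2/25 exceeds
    x^2/2. *)
Lemma large_gap_of_square (n m r M : nat) :
  5 <= r -> r <= m -> 2 * M <= r ^ 3 -> n ^ 2 + m * r ^ 2 <= m * M ->
  n ^ 2 + n < m * M /\ n ^ 3 < (m * M - n - n ^ 2) ^ 2.
Proof.
move=> r5 rm Mr nM.
have n2 : 2 * n ^ 2 <= m * r ^ 3 by nia.
have n5 : 5 * n <= m * r ^ 2.
  suff : (5 * n) ^ 2 <= (m * r ^ 2) ^ 2 by rewrite leq_exp2r.
  have : m * r ^ 3 * 25 <= (m * r ^ 2) ^ 2 * 2.
    have -> : (m * r ^ 2) ^ 2 = (m * r ^ 3) * (m * r).
      by rewrite !expnS !expn0; ring.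
    by rewrite -[leqRHS]mulnA leq_mul2l; apply/orP; right; nia.
  nia.
have n3 : 2 * n ^ 3 <= (m * r ^ 2) ^ 2.
  suff : (2 * n ^ 3) ^ 2 <= ((m * r ^ 2) ^ 2) ^ 2 by rewrite leq_exp2r.
  have h : (2 * n ^ 2) ^ 3 <= (m * r ^ 3) ^ 3 by rewrite leq_exp2r.
  have : (m * r ^ 3) ^ 3 <= ((m * r ^ 2) ^ 2) ^ 2.
    have -> : (m * r ^ 3) ^ 3 = m ^ 3 * r ^ 8 * r by rewrite !expnS !expn0; ring.
    have -> : ((m * r ^ 2) ^ 2) ^ 2 = m ^ 3 * r ^ 8 * m by rewrite !expnS !expn0; ring.
    by rewrite leq_mul2l rm orbT.
  have -> : (2 * n ^ 3) ^ 2 = 4 * n ^ 6 by rewrite !expnS !expn0; ring.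
  move: h; have -> : (2 * n ^ 2) ^ 3 = 8 * n ^ 6 by rewrite !expnS !expn0; ring.
  lia.
have x0 : 125 <= m * r ^ 2 by rewrite !expnS !expn0; nia.
move: n3 n5 nM x0; set x := m * r ^ 2 => n3 n5 nM x0.
split; first lia.
have : 4 * x <= 5 * (m * M - n - n ^ 2) by lia.
set z := m * M - _ - _ => zx.
have : (4 * x) ^ 2 <= (5 * z) ^ 2 by rewrite leq_exp2r.
rewrite !expnMn => h; nia.
Qed.

Local Open Scope ring_scope.

(** Writing e = E + 1, the last hypothesis says b < E^2. Hence g = b(b + E + 1) < E^2(E^2 + E + 1),
    which falls short of (E + 1)^4 - (E + 1)^3 by 2E^3 + 2E^2 + E > 0. *)
Lemma excess_bounds (g n : nat) (b := n%:R : algC) (e := g%:R / b - b) :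
  (0 < n)%N -> (n ^ 2 + n < g)%N -> (n ^ 3 < (g - n - n ^ 2) ^ 2)%N ->
  sqrtC b + 1 < e /\ g%:R < e ^+ 4 - e ^+ 3.
Proof.
move=> n0 ng n3g; pose E := (g - n - n ^ 2)%N%:R / b.
have b0 : 0 < b by rewrite ltr0n.
have bN0 : b != 0 by rewrite gt_eqF.
have eE : e = E + 1.
  rewrite /E /e -subnDA natrB; last by lia.
  by rewrite natrD natrX -/b; field.
have gE : g%:R = b * (b + E + 1).
  by rewrite -addrA -eE /e; field.
have E0 : 0 < E by rewrite divr_gt0 // ltr0n; lia.
have bE : b < E ^+ 2.
  rewrite /E expr_div_n ltr_pdivlMr ?exprn_gt0 // -exprS -!natrX ltr_nat.
  exact: n3g.
rewrite eE; split.
  by rewrite ltrD2r -(@ltr_pXn2r _ 2) ?nnegrE ?sqrtC_ge0 ?(ltW b0) ?(ltW E0) ?sqrtCK.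
rewrite gE; apply: (@lt_trans _ _ (E ^+ 2 * (E ^+ 2 + E + 1))).
  by rewrite ltr_pM ?(ltW b0) ?addr_ge0 ?(ltW b0) ?(ltW E0) // !ltrD2r.
rewrite -subr_gt0.
have -> : (E + 1) ^+ 4 - (E + 1) ^+ 3 - E ^+ 2 * (E ^+ 2 + E + 1)
  = E * (2%:R * E ^+ 2 + 2%:R * E + 1) by ring.
apply: mulr_gt0 => //; rewrite ltr_wpDl //.
by rewrite addr_ge0 // mulr_ge0 ?ler0n ?exprn_ge0 // ltW.
Qed.

(** The order on [algC] is only partial; degrees are natural numbers, so the maximum is moved to
    nat, where it is attained. *)
Lemma bmax_attained (gT : finGroupType) (G : {group gT}) :
  exists i : Iirr G, bmax G = 'chi_i 1%g.
Proof.
pose n (i : Iirr G) := Num.truncn ('chi_i 1%g).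
have nE i : 'chi_i 1%g = (n i)%:R by rewrite truncnK ?Cnat_irr1.
have natr_max : {morph (GRing.natmul (1 : algC)) : x y / maxn x y >-> Num.max x y}.
  by move=> x y; rewrite /maxn /Num.max/Order.max ltr_nat; case: ifP.
have [i ni] := @bigop.eq_bigmax _ n (ltac:(by rewrite card_ord)).
exists i; rewrite nE -ni (big_morph _ natr_max (erefl _)).
by apply: eq_bigr => j _; rewrite nE.
Qed.

(* For a product A of k copies of PSL_2(q): a = (q + 1)^k and d = q^k, the degree
   of the product of the Steinberg characters. *)
Definition has_borel_constituent (p a d : nat) (gT : finGroupType) (A : {group gT}) :=
  exists P : {group gT}, exists i : Iirr A,
    [/\ p.-Sylow(A)%g P, #|A : 'N_A(P)|%g = a, 'chi_i 1%g = d%:R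
      & '['Res['N_A(P)%g] 'chi_i, 1] != 0].

(** * Clifford theory over a normal subgroup *)

Section Clifford.
Variables (gT : finGroupType) (G N : {group gT}).
Hypothesis nsNG : (N <| G)%g.

(** Frattini argument: some n in N makes n y normalise P, hence N_N(P), while conjugation by n fixes
    ['chi_i]. Conjugation by n y is an isometry fixing the trivial character. *)
Lemma borel_constituent_orbit p (P : {group gT}) (i j : Iirr N) :
  p.-Sylow(N)%g P -> j \in cfclass_Iirr G i ->
  '['Res['N_N(P)%g] 'chi_j, 1] = '['Res['N_N(P)%g] 'chi_i, 1].
Proof.
move=> sylP; rewrite cfclass_IirrE => /cfclassP[y Gy ->].
have nNG := subsetP (normal_norm nsNG).
have sylPy : p.-Sylow(N)%g (P :^ y^-1)%G.
  by rewrite -(normP (nNG _ (groupVr Gy))) pHallJ2.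
have [n Nn Pn] := Sylow_trans sylP sylPy.
have zP : (n * y)%g \in 'N(P)%g.
  by apply/normP; rewrite conjsgM -Pn /= conjsgKV.
have zN : (n * y)%g \in 'N(N)%g.
  by rewrite nNG // groupM // (subsetP (normal_sub nsNG)).
have zH : (n * y)%g \in 'N('N_N(P))%g.
  by apply/normP; rewrite conjIg (normP zN) -normJ (normP zP).
have -> : ('chi_i ^ y)%CF = ('chi_i ^ (n * y)%g)%CF.
  by rewrite (cfConjgM _ nsNG) ?(cfConjg_id _ Nn) // (subsetP (normal_sub nsNG)).
by rewrite -cfConjgRes_norm // -[1 in LHS](cfConjg_cfun1 _ (n * y)%g) cfConjg_iso.
Qed.

(** Frobenius reciprocity puts every member of the orbit into the permutation character [pi]. They
    share one degree, so the degree of [pi] bounds their number. *)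
Lemma borel_constituent_card_orbit p (P : {group gT}) (i : Iirr N) :
  p.-Sylow(N)%g P -> '['Res['N_N(P)%g] 'chi_i, 1] != 0 ->
  #|cfclass_Iirr G i|%:R * 'chi_i 1%g <= #|N : 'N_N(P)|%g%:R.
Proof.
move=> sylP iP; pose pi := 'Ind[N, 'N_N(P)%g] 1.
have -> : #|N : 'N_N(P)|%g%:R = pi 1%g by rewrite cfInd1 ?subsetIl // cfun1E group1 mulr1.
have chpi : pi \is a character by rewrite cfInd_char ?rpred1 // cfun1_char.
rewrite [pi]cfun_sum_constt sum_cfunE.
rewrite mulr_natl -sumr_const big_mkcond [leRHS]big_mkcond /=.
apply: ler_sum => j _; rewrite cfunE; case: ifP => ji; last first.
  by case: ifP => // _; rewrite mulr_ge0 ?char1_ge0 ?irr_char // natr_ge0 // Cnat_cfdot_char_irr.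
have -> : 'chi_i 1%g = 'chi_j 1%g.
  by move: ji; rewrite cfclass_IirrE => /cfclassP[y _ ->]; rewrite cfConjg1.
have jpi : j \in irr_constt pi.
  by rewrite irr_consttE -Frobenius_reciprocity cfdotC (borel_constituent_orbit sylP ji) conjC_eq0.
rewrite jpi ler_peMl ?char1_ge0 ?irr_char //.
move: jpi; rewrite irr_consttE; have /natrP[m ->] := Cnat_cfdot_char_irr j chpi.
by rewrite pnatr_eq0 ler1n lt0n.
Qed.

(** By Clifford the restriction is c times the sum of the t orbit members, so ['chi_f] has degree c
    t theta(1) with theta = ['chi_j]. The norm c^2 t of the restriction is at most |G : N|. *)
Lemma irr1_sqr_le_orbit (f : Iirr G) (j : Iirr N) :
  j \in irr_constt ('Res[N] 'chi_f) ->
  'chi_f 1%g ^+ 2 <= #|G : N|%g%:R * (#|cfclass_Iirr G j|%:R * 'chi_j 1%g ^+ 2).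
Proof.
move=> jf; set c := '['Res[N] 'chi_f, 'chi_j]; set t := #|_|%:R.
have resE : 'Res[N] 'chi_f = c *: \sum_(k in cfclass_Iirr G j) 'chi_k.
  rewrite (Clifford_Res_sum_cfclass nsNG jf) reindex_cfclass //.
  by congr (_ *: _); apply: eq_bigl => k; rewrite cfclass_IirrE.
have c_nat : c \is a Num.nat by rewrite Cnat_cfdot_char_irr ?cfRes_char ?irr_char.
have f1 : 'chi_f 1%g = c * (t * 'chi_j 1%g).
  rewrite -(cfRes1 N) resE cfunE sum_cfunE; congr (_ * _).
  rewrite mulr_natl -sumr_const; apply: eq_bigr => k.
  by rewrite cfclass_IirrE => /cfclassP[y _ ->]; rewrite cfConjg1.
have cct : c ^+ 2 * t <= #|G : N|%g%:R.
  have := cfnorm_Res_leif 'chi_f (normal_sub nsNG); rewrite cfnorm_irr mulr1 => -[le _].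
  apply: le_trans le; rewrite resE cfnormZ norm_natr // cfdot_suml.
  rewrite /t -sumr_const ler_wpM2l ?exprn_ge0 ?natr_ge0 //.
  apply: ler_sum => k kj; rewrite cfdot_sumr (bigD1 k) //= cfnorm_irr big1 ?addr0 //.
  by move=> l /andP[_ /negPf lk]; rewrite cfdot_irr eq_sym lk.
have -> : 'chi_f 1%g ^+ 2 = c ^+ 2 * t * (t * 'chi_j 1%g ^+ 2) by rewrite f1; ring.
by rewrite ler_wpM2r // mulr_ge0 ?ler0n // exprn_ge0 // char1_ge0 ?irr_char.
Qed.

Lemma orbit_sqr_le_card (i j : Iirr N) :
  i \notin cfclass_Iirr G j ->
  #|cfclass_Iirr G j|%:R * 'chi_j 1%g ^+ 2 + 'chi_i 1%g ^+ 2 <= #|N|%:R.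
Proof.
move=> ij; rewrite -irr_sum_square (bigD1 i) //= addrC lerD2r.
rewrite mulr_natl -sumr_const big_mkcond [leRHS]big_mkcond /=.
apply: ler_sum => k _; case: ifP => [kj|_].
  rewrite (_ : k != i) /=; last by apply: contraNneq ij => <-.
  by move: kj; rewrite cfclass_IirrE => /cfclassP[y _ ->]; rewrite cfConjg1.
by case: ifP => // _; rewrite exprn_ge0 // char1_ge0 ?irr_char.
Qed.

(** The cases are whether the given character of degree d lies in the orbit under f. If so, the t
    orbit members satisfy t d <= a, so t d^2 <= a d; if not, the orbit misses a term d^2 of the sum
    of squares |N|. *)
Lemma irr1_sqr_alternative (p a d n : nat) (f : Iirr G) :
  has_borel_constituent p a d N -> 'chi_f 1%g = n%:R ->
  (n ^ 2 <= #|G : N|%g * (a * d))%N \/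
  (n ^ 2 + #|G : N|%g * d ^ 2 <= #|G : N|%g * #|N|)%N.
Proof.
move=> [P [i [sylP iP di resi]]] fn.
have [j jf] : exists j, j \in irr_constt ('Res[N] 'chi_f).
  by case: (constt_cfRes_irr N f) => j; exists j.
have := irr1_sqr_le_orbit jf; rewrite fn -natrX => nS.
have [ij|ij] := boolP (i \in cfclass_Iirr G j).
  left; rewrite -(@ler_nat algC); apply: le_trans nS _.
  have ji : j \in cfclass_Iirr G i.
    by rewrite !cfclass_IirrE in ij *; rewrite cfclass_sym.
  have -> : cfclass_Iirr G j = cfclass_Iirr G i by apply/eqP; rewrite eq_cfclass_IirrE.
  have -> : 'chi_j 1%g = 'chi_i 1%g.
    by move: ji; rewrite cfclass_IirrE => /cfclassP[y _ ->]; rewrite cfConjg1.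
  rewrite !natrM ler_wpM2l ?ler0n // expr2 mulrA -di ler_wpM2r //.
    by rewrite char1_ge0 ?irr_char.
  by rewrite -iP; apply: (borel_constituent_card_orbit sylP).
right; rewrite -(@ler_nat algC) natrD (natrM _ _ (d ^ 2)) (natrM _ _ #|N|) (natrX _ d) -di.
apply: le_trans (_ : #|G : N|%g%:R * (#|cfclass_Iirr G j|%:R * 'chi_j 1%g ^+ 2 + 'chi_i 1%g ^+ 2) <= _).
  by rewrite mulrDr lerD2r.
by rewrite ler_wpM2l ?ler0n // orbit_sqr_le_card.
Qed.

End Clifford.
(** * Direct products *)

Section Product.
Variables (gT : finGroupType) (p : nat).
Implicit Types A P : {group gT}.

Lemma Sylow_dprod A A1 A2 P1 P2 P :
  (A1 \x A2 = A)%g -> (P1 \x P2 = P)%g ->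
  p.-Sylow(A1)%g P1 -> p.-Sylow(A2)%g P2 -> p.-Sylow(A)%g P.
Proof.
move=> defA defP /pHallP[sP1 oP1] /pHallP[sP2 oP2]; apply/pHallP; split.
  by rewrite -(dprodW defA) -(dprodW defP) mulgSS.
by rewrite -(dprod_card defA) -(dprod_card defP) partnM ?oP1 ?oP2.
Qed.

(** Each P_i is the intersection of P with the normal factor A_i, so N_A(P) normalises both. If x =
    y z lies in N_A(P), then z centralises P1 and y centralises P2, so y normalises P1 and z
    normalises P2. *)
Lemma norm_Sylow_dprod A A1 A2 P1 P2 P :
  (A1 \x A2 = A)%g -> (P1 \x P2 = P)%g ->
  p.-Sylow(A1)%g P1 -> p.-Sylow(A2)%g P2 ->
  ('N_A1(P1) \x 'N_A2(P2) = 'N_A(P))%g.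
Proof.
move=> defA defP sylP1 sylP2; have sylP := Sylow_dprod defA defP sylP1 sylP2.
have [nsA1 nsA2] := dprod_normal2 defA.
have [_ mulA cA12 tiA] := dprodP defA; have [_ mulP _ _] := dprodP defP.
have inter A' P' : (A' <| A)%g -> p.-Sylow(A')%g P' -> P' \subset P ->
    'N_A(P)%g \subset 'N(P')%g.
  move=> nsA' sylP' sP'P.
  have -> : (P' : {set gT}) = (A' :&: P)%g.
    apply/eqP; rewrite eqEcard subsetI (pHall_sub sylP') sP'P /=.
    by rewrite (card_Hall sylP') (card_Hall (Sylow_setI_normal nsA' sylP)).
  by rewrite normsI ?subsetIr // subIset // normal_norm.
have nP1 : 'N_A(P)%g \subset 'N(P1)%g.
  by apply: inter nsA1 sylP1 _; rewrite -mulP mulG_subl.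
have nP2 : 'N_A(P)%g \subset 'N(P2)%g.
  by apply: inter nsA2 sylP2 _; rewrite -mulP mulG_subr.
have c1 : A2 \subset 'N(P1)%g.
  by rewrite cents_norm // (subset_trans cA12) // centS // (pHall_sub sylP1).
have c2 : A1 \subset 'N(P2)%g.
  by rewrite cents_norm // centsC (subset_trans (pHall_sub sylP2)).
rewrite dprodE; first last.
- by apply/trivgP; rewrite -tiA setISS ?subsetIl.
- by apply: subset_trans (centS (subsetIl _ _)); rewrite subIset // cA12.
apply/eqP; rewrite eqEsubset; apply/andP; split.
  rewrite subsetI -mulA mulgSS ?subsetIl //= mul_subG // -mulP.
    by rewrite normsM ?subsetIr // subIset // c2.
  by rewrite normsM ?subsetIr // subIset // c1.
apply/subsetP=> x Nx; have Ax : x \in A by case/setIP: Nx.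
have := Ax; rewrite -mulA => /mulsgP[y z A1y A2z xE].
rewrite xE mem_mulg // inE ?A1y ?A2z /=.
  by rewrite -(groupMr _ (subsetP c1 _ A2z)) -xE (subsetP nP1).
by rewrite -(groupMl _ (subsetP c2 _ A1y)) -xE (subsetP nP2).
Qed.

(** The witness is the product of the two characters: its restriction to the normaliser, itself a
    direct product, splits, and inner products multiply. *)
Lemma has_borel_constituent_dprod a1 d1 a2 d2 A A1 A2 :
  (A1 \x A2 = A)%g ->
  has_borel_constituent p a1 d1 A1 -> has_borel_constituent p a2 d2 A2 ->
  has_borel_constituent p (a1 * a2) (d1 * d2) A.
Proof.
move=> defA [P1 [i1 [sylP1 ia1 id1 r1]]] [P2 [i2 [sylP2 ia2 id2 r2]]].
have [_ _ cA tiA] := dprodP defA.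
have defP : (P1 \x P2 = (P1 <*> P2)%G)%g.
  rewrite dprodEY //.
    apply: subset_trans (pHall_sub sylP2) (subset_trans cA _).
    exact: centS (pHall_sub sylP1).
  by apply/trivgP; rewrite -tiA setISS // ?(pHall_sub sylP1) ?(pHall_sub sylP2).
have defN := norm_Sylow_dprod defA defP sylP1 sylP2.
exists (P1 <*> P2)%G, (dprod_Iirr defA (i1, i2)); split.
- exact: Sylow_dprod defA defP sylP1 sylP2.
- apply/eqP; rewrite -(eqn_pmul2l (cardG_gt0 'N_A(P1 <*> P2))) Lagrange ?subsetIl //.
  rewrite -(dprod_card defA) -(dprod_card defN) -ia1 -ia2.
  by rewrite mulnACA !Lagrange ?subsetIl.
- by rewrite dprod_IirrE cfDprod1 id1 id2 natrM.
rewrite dprod_IirrE.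
have -> : 'Res['N_A(P1 <*> P2)%G] (cfDprod defA 'chi_i1 'chi_i2)
    = cfDprod defN ('Res['N_A1(P1)%G] 'chi_i1) ('Res['N_A2(P2)%G] 'chi_i2).
  apply/cfun_inP=> x Nx; rewrite cfResE ?subsetIl //.
  have /mulsgP[y z Ny Nz ->] : x \in ('N_A1(P1) * 'N_A2(P2))%g by rewrite (dprodW defN).
  have [Ay _] := setIP Ny; have [Az _] := setIP Nz.
  by rewrite !cfDprodE //= !cfResE ?subsetIl.
by rewrite -(cfDprod_cfun1 defN) cfdot_dprod mulf_neq0.
Qed.

Lemma has_borel_constituent_bigdprod a d k (As : 'I_k -> {group gT}) A :
  \big[dprod/1%g]_(i < k) As i = A ->
  (forall i, has_borel_constituent p a d (As i)) ->
  has_borel_constituent p (a ^ k) (d ^ k) A.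
Proof.
elim: k As A => [|k IHk] As A.
  rewrite big_ord0 => /esym/group_inj-> _; exists 1%G, 0; split.
  - by rewrite pHallE subxx cards1 partn1.
  - by rewrite (setIidPl _) ?indexgg ?sub1G.
  - by rewrite irr0 cfun11.
  by rewrite irr0 cfRes_cfun1 ?subsetIl // cfnorm1 oner_neq0.
rewrite big_ord_recl => defA hAs; have [[_ B _ defB] _ _ _] := dprodP defA.
rewrite !expnS; apply: has_borel_constituent_dprod (hAs ord0) (IHk _ _ defB _).
  by rewrite -defB.
by move=> i; apply: hAs.
Qed.

End Product.

(** * The Steinberg character *)

(* Models a Borel subgroup B of A with unipotent radical P. *)
Definition borel_pair (q : nat) (gT : finGroupType) (A B P : {group gT}) :=
  [/\ (P <| B)%g, B \subset A, #|P| = q, #|A : B|%g = q.+1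
    & forall y, y \in A -> y \notin B -> (P :&: B :^ y = 1)%g].

Section BorelPair.
Variables (gT : finGroupType) (p q : nat) (A B P : {group gT}).
Hypotheses (q_gt1 : (1 < q)%N) (bp : borel_pair q A B P).

(** An element y outside B normalising P would put P inside B^y, forcing P = 1 against q > 1. *)
Lemma borel_pair_norm : ('N_A(P) = B)%g.
Proof.
have [nsPB sBA oP _ tiP] := bp.
apply/eqP; rewrite eqEsubset andbC subsetI sBA normal_norm //=.
apply/subsetP=> y /setIP[Ay /normP Py]; apply: contraT => By.
have := tiP y Ay By; rewrite (setIidPl _) => [P1|].
  by move: q_gt1; rewrite -oP P1 cards1.
by rewrite -{1}Py conjSg normal_sub.
Qed.

(** P meets the intersection of B and B^y trivially, so their product set, inside B, has full
    size. *)
Lemma borel_pair_cardI y : y \in A -> y \notin B -> (q * #|B :&: B :^ y|%g <= #|B|)%N.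
Proof.
have [nsPB sBA oP _ tiP] := bp => Ay By.
have ti : (P :&: (B :&: B :^ y) = 1)%g.
  by rewrite setIA (setIidPl (normal_sub nsPB)) tiP.
rewrite -oP -(TI_cardMg (G := P) (H := (B :&: B :^ y)%G) ti) subset_leq_card //.
by rewrite mul_subG ?(normal_sub nsPB) //= subsetIl.
Qed.

(* This is the 2-transitivity of A on the cosets of B: up to the factor |B|^2, the
   norm counts the pairs (x, y) in B * A with x ^ y in B. *)
Lemma borel_pair_cfnorm_le2 : '['Ind[A, B] 1] <= 2%:R.
Proof.
have [nsPB sBA oP iB tiP] := bp.
rewrite -Frobenius_reciprocity cfdotC cfdotE rmorphM rmorph_sum fmorphV rmorph_nat /=.
pose c := (\sum_(y in A) #|B :&: B :^ y^-1|%g)%N.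
have -> : \sum_(x in B) ('Res[B] ('Ind[A, B] 1) x * ((1 : 'CF(B)) x)^*)^*
    = #|B|%:R^-1 * c%:R.
  have -> : c%:R = \sum_(x in B) \sum_(y in A) ((x ^ y)%g \in B)%:R :> algC.
    rewrite exchange_big natr_sum; apply: eq_bigr => y _ /=.
    rewrite -sum1_card natr_sum; under eq_bigl => x do rewrite inE mem_conjgV.
    by rewrite big_mkcondr; apply: eq_bigr => x _; case: ifP.
  rewrite mulr_sumr; apply: eq_bigr => x Bx.
  rewrite cfResE // cfun1E Bx rmorphM /= conjCK mulr1 cfIndE // rmorphM fmorphV rmorph_nat.
  by rewrite rmorph_sum; congr (_ * _); apply: eq_bigr => y _; rewrite cfun1E rmorph_nat.
rewrite mulrA -invfM mulrC ler_pdivrMr ?mulr_gt0 ?ltr0n //.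
rewrite -!natrM ler_nat /c.
(* Each y in B contributes |B|; each of the q|B| elements outside B contributes at most |B|/q. The
   total is at most 2|B|^2. *)
rewrite (big_setID B) /= (setIidPr sBA) -(@leq_pmul2l q) ?mulnDr; last by lia.
rewrite (_ : (\sum_(y in B) _ = #|B| * #|B|)%N); last first.
  rewrite -sum_nat_const; apply: eq_bigr => y By.
  by rewrite conjGid ?groupV // setIid.
have : (q * \sum_(y in A :\: B) #|B :&: B :^ y^-1|%g <= #|A :\: B| * #|B|)%N.
  rewrite big_distrr /= -sum_nat_const; apply: leq_sum => y /setDP[Ay By].
  by rewrite borel_pair_cardI ?groupV.
have -> : (#|A :\: B| = q * #|B|)%N.
  by rewrite cardsD (setIidPr sBA) -(Lagrange sBA) iB mulnS addKn mulnC.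
by rewrite muln0 addn0 leq_add2l -mulnA.
Qed.

(** The permutation character on the q + 1 cosets of B is 1 + psi; norm at most 2 and degree q > 0
    force psi to be irreducible. This psi is the Steinberg character, and Frobenius reciprocity
    gives its trivial constituent on B = N_A(P). *)
Lemma borel_pair_has_borel_constituent :
  p.-Sylow(A)%g P -> has_borel_constituent p q.+1 q A.
Proof.
move=> sylP; have [_ sBA _ iB _] := bp; set pi := 'Ind[A, B] 1.
have chpi : pi \is a character by rewrite cfInd_char ?cfun1_char.
have pi1 : '[pi, 1] = 1 by rewrite -Frobenius_reciprocity cfRes_cfun1 // cfnorm1.
have [psi chpsi piE] : exists2 psi, psi \is a character & pi = 1 + psi.
  have /(constt_charP _ chpi) : 0 \in irr_constt pi.
    by rewrite irr_consttE irr0 pi1 oner_neq0.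
  by rewrite irr0.
have psi1 : '[psi, 1] = 0.
  by apply: (addrI 1); rewrite addr0 -[RHS]pi1 piE cfdotDl cfnorm1.
have psi_q : psi 1%g = q%:R.
  have := cfInd1 (1 : 'CF(B)) sBA.
  by rewrite -/pi piE cfunE !cfun11 iB mulr1 mulrS => /addrI.
have psi_irr : psi \in irr A.
  rewrite irrEchar chpsi /=.
  have /natrP[n psi_n] := Cnat_cfdot_char chpsi chpsi.
  have : 1 + '[psi] <= 2%:R.
    suff -> : 1 + '[psi] = '[pi] by apply: borel_pair_cfnorm_le2.
    by rewrite [in RHS]piE cfdotDl !cfdotDr cfnorm1 psi1 (cfdotC 1) psi1 conjC0 addr0 add0r.
  rewrite -[2%:R]/(1 + 1) lerD2l psi_n lern1 -[1]/(1%:R) eqr_nat.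
  case: n psi_n => [|[|n]] // /eqP; rewrite cfnorm_eq0 => /eqP psi0.
  by move: psi_q q_gt1; rewrite psi0 cfunE => /eqP; rewrite eq_sym pnatr_eq0 => /eqP->.
have [i psi_i] := irrP psi_irr.
exists P, i; rewrite borel_pair_norm -psi_i; split=> //.
have := borel_pair_norm => /group_inj defN.
suff: '['Res[B] psi, 1] != 0 by rewrite -defN.
rewrite cfdotC Frobenius_reciprocity -/pi piE cfdotDl cfdotC psi1 conjC0 add0r conjC_eq0.
by move: psi_irr; rewrite irrEchar => /andP[_ /eqP->]; apply: oner_neq0.
Qed.

End BorelPair.

(** Being normal in A, the kernel lies in every conjugate of B, so membership in B^y can be tested
    before applying f. *)
Lemma morphim_borel_pair (aT rT : finGroupType) (D : {group aT})
    (f : {morphism D >-> rT}) q (A B P : {group aT}) :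
  (0 < q)%N -> A \subset D -> ('ker_A f)%g \subset B ->
  borel_pair q A B P -> borel_pair q (f @* A)%G (f @* B)%G (f @* P)%G.
Proof.
move=> q0 sAD kerB [nsPB sBA oP iB tiP].
have sPB := normal_sub nsPB; have sPA := subset_trans sPB sBA.
have sBD := subset_trans sBA sAD; have sPD := subset_trans sPA sAD.
have kerN y : y \in A -> ('ker_A f)%g \subset (B :^ y)%g.
  by move=> Ay; rewrite -(normsP (normsI (normG A) (subset_trans sAD (ker_norm f))) _ Ay) conjSg.
split.
- exact: morphim_normal.
- exact: morphimS.
- rewrite -oP card_morphim (setIidPr sPD) -indexgI (_ : P :&: _ = 1)%g ?indexg1 //.
  (* Such a y exists since |A : B| = q + 1 > 1; the kernel then meets P inside the trivial
     intersection of P and B^y. *)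
  have [y Ay By] : exists2 y, y \in A & y \notin B.
    apply/subsetPn; apply/negP => sAB; move: iB.
    by rewrite (_ : #|A : B|%g = 1)%N; [case: q q0 {oP} | apply/eqP; rewrite indexg_eq1].
  apply/trivgP; rewrite -(tiP y Ay By) subsetI subsetIl.
  by rewrite (subset_trans _ (kerN y Ay)) // setSI.
- rewrite -iB -(index_morphim_ker f sBA sAD) /=.
  by rewrite (_ : #|('ker_A f)%g : B|%g = 1)%N ?muln1 //; apply/eqP; rewrite indexg_eq1.
move=> _ /morphimP[y Dy Ay ->] fBy.
have By : y \notin B by apply: contra fBy; apply: mem_morphim.
apply/trivgP/subsetP=> _ /setIP[/morphimP[u Du Pu ->]].
rewrite /= -morphimJ // => /morphimP[v Dv Bv fuv].
suff Bu : u \in (B :^ y)%g.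
  by have : u \in (P :&: B :^ y)%g; [rewrite inE Pu | rewrite tiP // => /set1P->; rewrite morph1 set11].
have Av : v \in A by rewrite -(normsP (normG A) y Ay) (subsetP _ _ Bv) // conjSg.
have Kw : (u * v^-1)%g \in ('ker_A f)%g.
  apply/setIP; split; first by rewrite groupM ?groupV ?(subsetP sPA _ Pu).
  apply/kerP; first by rewrite groupM ?groupV.
  by rewrite morphM ?groupV // morphV // fuv mulgV.
by rewrite -(mulgKV v u) groupM // (subsetP (kerN y Ay)).
Qed.
(** * The groups SL_2(q) and PSL_2(q) *)

Section SL2.
Variable F : finFieldType.
Implicit Types g h u : {'GL_2[F]}.

Lemma mulmx2E (M M' : 'M[F]_2) i j : (M *m M') i j = M i 0 * M' 0 j + M i 1 * M' 1 j.
Proof.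
rewrite mxE !big_ord_recl big_ord0 addr0.
by rewrite (_ : lift ord0 ord0 = 1) //; apply: val_inj.
Qed.

Lemma det_mx2 (M : 'M[F]_2) : \det M = M 0 0 * M 1 1 - M 0 1 * M 1 0.
Proof.
rewrite (expand_det_row _ 0) !big_ord_recl big_ord0 addr0 /cofactor !det_mx11 !mxE /=.
rewrite expr0 expr1 mul1r mulN1r mulrN.
by congr (M _ _ * M _ _ - M _ _ * M _ _); apply: val_inj.
Qed.

Lemma mx2P (M M' : 'M[F]_2) :
  M 0 0 = M' 0 0 -> M 0 1 = M' 0 1 -> M 1 0 = M' 1 0 -> M 1 1 = M' 1 1 -> M = M'.
Proof.
move=> h00 h01 h10 h11; apply/matrixP => i j.
have I2 (k : 'I_2) : k = 0 \/ k = 1.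
  by case: k => [[|[|k]] // lk]; [left | right]; apply: val_inj.
by case: (I2 i) => ->; case: (I2 j) => ->.
Qed.

Definition mx2 (a b c d : F) : 'M[F]_2 :=
  \matrix_(i, j) if i == 0 then if j == 0 then a else b else if j == 0 then c else d.

Definition ent g (i j : 'I_2) : F := (GLval g : 'M[F]_2) i j.

Lemma GLval_inj : injective (@GLval 2 F).
Proof. exact: val_inj. Qed.

Lemma entP g h : ent g 0 0 = ent h 0 0 -> ent g 0 1 = ent h 0 1 ->
  ent g 1 0 = ent h 1 0 -> ent g 1 1 = ent h 1 1 -> g = h.
Proof. by move=> *; apply/GLval_inj/mx2P. Qed.

Lemma entM g h i j : ent (g * h)%g i j = ent g i 0 * ent h 0 j + ent g i 1 * ent h 1 j.
Proof. by rewrite /ent GL_MxE mulmx2E. Qed.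

Lemma ent1 i j : ent 1%g i j = (i == j)%:R.
Proof. by rewrite /ent GL_1E mxE. Qed.

Lemma group_set_SL2 : group_set (SL2_set F).
Proof.
apply/group_setP; split=> [|g h]; rewrite !inE; first by rewrite GL_1E det1.
by rewrite GL_MxE det_mulmx => /eqP-> /eqP->; rewrite mul1r.
Qed.

Lemma mem_SL2 g : (g \in SL2 F) = (ent g 0 0 * ent g 1 1 - ent g 0 1 * ent g 1 0 == 1).
Proof. by rewrite /= (gen_set_id group_set_SL2) inE det_mx2. Qed.

Lemma SL2_ex a b c d : a * d - b * c = 1 -> exists2 g, g \in SL2 F &
  [/\ ent g 0 0 = a, ent g 0 1 = b, ent g 1 0 = c & ent g 1 1 = d].
Proof.
move=> det1; have Ud : mx2 a b c d \is a GRing.unit.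
  by rewrite unitmxE det_mx2 !mxE /= det1 unitr1.
pose g : {'GL_2[F]} := FinRing.Unit Ud.
have ge : [/\ ent g 0 0 = a, ent g 0 1 = b, ent g 1 0 = c & ent g 1 1 = d].
  by rewrite /ent !mxE.
by exists g => //; rewrite mem_SL2; case: ge => -> -> -> ->; apply/eqP.
Qed.

Lemma group_set_borel : group_set [set g in SL2 F | ent g 1 0 == 0].
Proof.
apply/group_setP; split=> [|g h]; first by rewrite inE group1 ent1 /=.
rewrite !inE => /andP[Sg /eqP g0] /andP[Sh /eqP h0].
by rewrite groupM //= entM g0 h0 mul0r mulr0 addr0.
Qed.
Canonical SL2_borel := Group group_set_borel.

Lemma group_set_unipotent : group_set [set g in SL2_borel | ent g 0 0 == 1].
Proof.
apply/group_setP; split=> [|g h]; first by rewrite inE group1 ent1 /=.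
move=> /setIdP[Bg /eqP g0] /setIdP[Bh /eqP h0]; have /setIdP[_ /eqP h1] := Bh.
by apply/setIdP; rewrite groupM // entM g0 h0 h1 mul1r mulr0 addr0.
Qed.
Canonical SL2_unipotent := Group group_set_unipotent.

Lemma SL2_borelP g : g \in SL2_borel ->
  [/\ g \in SL2 F, ent g 1 0 = 0 & ent g 0 0 * ent g 1 1 = 1].
Proof.
rewrite inE => /andP[Sg /eqP g0]; split=> //.
by move: Sg; rewrite mem_SL2 g0 mulr0 subr0 => /eqP.
Qed.

Lemma SL2_unipotentP g : g \in SL2_unipotent ->
  [/\ g \in SL2_borel, ent g 1 0 = 0, ent g 0 0 = 1 & ent g 1 1 = 1].
Proof.
rewrite inE => /andP[Bg /eqP g0]; have [_ h1 h2] := SL2_borelP Bg.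
by split=> //; rewrite -h2 g0 mul1r.
Qed.

Lemma card_SL2_unipotent : #|SL2_unipotent| = #|F|.
Proof.
rewrite -(@card_in_imset _ _ (fun g => ent g 0 1)); last first.
  move=> g h /SL2_unipotentP[_ a b c] /SL2_unipotentP[_ a' b' c'] /= gh.
  by apply: entP; rewrite ?a ?a' ?b ?b' ?c ?c'.
rewrite -cardsT; congr #|pred_of_set _|; apply/setP => x; rewrite inE.
have [|g Sg [h1 h2 h3 h4]] := @SL2_ex 1 x 0 1; first by rewrite mulr0 subr0 mulr1.
by apply/imsetP; exists g; rewrite // inE h1 inE Sg h3 !eqxx.
Qed.

Lemma card_SL2_borel : #|SL2_borel| = (#|F|.-1 * #|F|)%N.
Proof.
rewrite -(@card_in_imset _ _ (fun g => (ent g 0 0, ent g 0 1))); last first.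
  move=> g h /SL2_borelP[_ a b] /SL2_borelP[_ a' b'] [/= h1 h2].
  apply: entP; rewrite ?a ?a' //.
  apply: (@mulfI _ (ent g 0 0)); last by rewrite b h1 b'.
  by apply: contra_eq_neq b => ->; rewrite mul0r eq_sym oner_neq0.
rewrite -(cardsC1 (0 : F)) -cardsT -cardsX; congr #|pred_of_set _|.
apply/setP=> -[a b]; rewrite !inE andbT /=; apply/imsetP/idP.
  case=> g /SL2_borelP[_ _ ad] [-> _].
  by apply: contra_eq_neq ad => ->; rewrite mul0r eq_sym oner_neq0.
move=> /= a0; have [|g Sg [h1 h2 h3 h4]] := @SL2_ex a b 0 a^-1.
  by rewrite mulr0 subr0 divff.
by exists g; rewrite ?inE ?Sg ?h3 ?eqxx ?h1 ?h2.
Qed.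

(** With lower-left entry c nonzero, the diagonal entries a, d are free and the remaining entry must
    be (a d - 1)/c. *)
Lemma card_SL2_diff_borel : #|SL2 F :\: SL2_borel| = (#|F|.-1 * (#|F| * #|F|))%N.
Proof.
rewrite -(@card_in_imset _ _ (fun g => (ent g 1 0, (ent g 0 0, ent g 1 1)))); last first.
  move=> g h; rewrite !inE => /andP[gB Sg] /andP[hB Sh] [/= h1 h2 h3].
  apply: entP => //; move: gB; rewrite Sg /= => g0.
  apply: (mulIf g0); move: Sg Sh; rewrite !mem_SL2 h2 h3 -h1 => /eqP <- /eqP.
  by move/addrI/oppr_inj => ->.
rewrite -(cardsC1 (0 : F)) -cardsT -!cardsX; congr #|pred_of_set _|.
apply/setP=> -[c [a d]]; rewrite !inE !andbT /=; apply/imsetP/idP.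
  by case=> g; rewrite !inE => /andP[gB Sg] [-> _ _]; move: gB; rewrite Sg.
move=> /= c0; have [|g Sg [h1 h2 h3 h4]] := @SL2_ex a ((a * d - 1) / c) c d.
  by field.
by exists g; rewrite ?inE ?Sg ?h3 ?c0 ?h1 ?h4.
Qed.

Lemma SL2_borel_sub : SL2_borel \subset SL2 F.
Proof. by apply/subsetP=> g /SL2_borelP[]. Qed.

Lemma card_SL2 : #|SL2 F| = (#|F| * #|F|.-1 * #|F|.+1)%N.
Proof.
rewrite -(cardsID SL2_borel) (setIidPr SL2_borel_sub) card_SL2_borel.
by rewrite card_SL2_diff_borel; ring.
Qed.

Lemma SL2_borel_pair : borel_pair #|F| (SL2 F) SL2_borel SL2_unipotent.
Proof.
have F1 : (0 < #|F|.-1)%N by rewrite -subn1 subn_gt0 finNzRing_gt1.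
have F0 : (0 < #|F|)%N := ltnW (finNzRing_gt1 _).
split; last 1 first.
- move=> y Sy yB; have y0 : ent y 1 0 != 0 by move: yB; rewrite inE Sy.
  apply/trivgP/subsetP => u /setIP[Pu].
  have [Bu u10 u00 u11] := SL2_unipotentP Pu.
  case/imsetP=> b /SL2_borelP[_ b10 b11] ub.
  (* The bottom row of this equation, with the lower-left entry of y nonzero, gives first b_11 = 1
     and then u_01 = 0. *)
  have E : (b * y = y * u)%g by rewrite ub -conjgC.
  have E1 : ent b 1 1 * ent y 1 0 = ent y 1 0.
    have := congr1 (fun g => ent g 1 0) E.
    by rewrite /= !entM b10 u10 u00 mul0r add0r mulr0 mulr1 addr0.
  have {E1} b1 : ent b 1 1 = 1 by apply: (mulIf y0); rewrite E1 mul1r.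
  have : ent y 1 1 = ent y 1 0 * ent u 0 1 + ent y 1 1.
    have := congr1 (fun g => ent g 1 1) E.
    by rewrite /= !entM b10 b1 u11 mul0r add0r mul1r mulr1.
  rewrite -[LHS]add0r => /addIr/esym/eqP; rewrite mulf_eq0 (negPf y0) /= => /eqP u01.
  by apply/set1P; apply: entP; rewrite ?u01 ?u10 ?u00 ?u11 ent1.
- rewrite /normal; apply/andP; split; first by apply/subsetP=> u /SL2_unipotentP[].
  apply/subsetP=> b Bb; rewrite inE; apply/subsetP=> _ /imsetP[u Pu ->].
  have [Bu u10 u00 u11] := SL2_unipotentP Pu; have [_ b10 bd] := SL2_borelP Bb.
  have := groupJ Bu Bb; move: (conjgC u b); move: (u ^ b)%g => v E Bv.
  have [_ v10 _] := SL2_borelP Bv; rewrite inE Bv /=.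
  have := congr1 (fun g => ent g 0 0) E.
  rewrite /= !entM u00 b10 v10 !mulr0 !addr0 mul1r -[LHS]mulr1 => /mulfI <- //.
  by apply: contra_eq_neq bd => ->; rewrite mul0r eq_sym oner_neq0.
- exact: SL2_borel_sub.
- exact: card_SL2_unipotent.
apply/eqP; rewrite -(eqn_pmul2l (cardG_gt0 SL2_borel)) Lagrange ?SL2_borel_sub //.
by rewrite card_SL2 card_SL2_borel; apply/eqP; ring.
Qed.

(** It suffices to commute with the upper and lower elementary matrices [u] and [l]; the determinant
    gives the last equation. *)
Lemma SL2_center g : g \in 'Z(SL2 F)%g ->
  [/\ ent g 1 0 = 0, ent g 0 1 = 0, ent g 0 0 = ent g 1 1 & ent g 0 0 ^+ 2 = 1].
Proof.
case/centerP=> Sg cg.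
have [|u Su [u00 u01 u10 u11]] := @SL2_ex 1 1 0 1; first by rewrite mulr0 subr0 mulr1.
have [|l Sl [l00 l01 l10 l11]] := @SL2_ex 1 0 1 1; first by rewrite mul0r subr0 mulr1.
have E1 := congr1 (fun g => ent g 0 0) (cg u Su).
have E2 := congr1 (fun g => ent g 0 1) (cg u Su).
have E3 := congr1 (fun g => ent g 0 0) (cg l Sl).
move: E1 E2 E3; rewrite /= !entM u00 u01 u10 u11 l00 l01 l10.
rewrite !mulr1 !mul1r !mulr0 !mul0r !addr0 => E1 E2 E3.
have g10 : ent g 1 0 = 0 by apply: (addrI (ent g 0 0)); rewrite addr0.
have g01 : ent g 0 1 = 0 by apply: (addrI (ent g 0 0)); rewrite addr0.
have gg : ent g 0 0 = ent g 1 1 by move: E2; rewrite g01 addr0 add0r.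
by split=> //; move: Sg; rewrite mem_SL2 g10 mulr0 subr0 -gg -expr2 => /eqP.
Qed.

Lemma SL2_center_borel : 'Z(SL2 F)%g \subset SL2_borel.
Proof.
apply/subsetP=> g Zg; have [g10 _ _ _] := SL2_center Zg.
by rewrite inE g10 eqxx (subsetP (center_sub _) _ Zg).
Qed.

Lemma card_SL2_center : odd #|F| -> #|'Z(SL2 F)%g| = 2.
Proof.
move=> oddF.
have two : (1 : F) != -1.
  rewrite eq_sym -subr_eq0 -opprD oppr_eq0; apply/eqP => two0.
  (* In characteristic 2 the order of F is a power of 2; being odd, it would be 1. *)
  have : 2%N \in [pchar F] by rewrite inE /= mulr2n two0 eqxx.
  move=> /fin_ring_pchar_abelem/abelem_pgroup/p_natP[n].
  rewrite cardsT => oF; move: oddF (finNzRing_gt1 F); rewrite oF oddX orbF.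
  by move=> /eqP->.
have [|m Sm [m00 m01 m10 m11]] := @SL2_ex (-1) 0 0 (-1); first by rewrite mulr0 subr0 mulrNN mulr1.
have m1 : m != 1%g by apply: contra_neq two => m1; rewrite -m00 m1 ent1.
suff -> : 'Z(SL2 F)%g = [set 1%g; m] by rewrite cards2 eq_sym m1.
apply/setP=> g; rewrite in_set2; apply/idP/idP.
  case/SL2_center => g10 g01 gg /eqP; rewrite sqrf_eq1 => /orP[]/eqP g00.
    by apply/orP; left; apply/eqP; apply: entP; rewrite ?ent1 -?gg ?g00 ?g01 ?g10.
  by apply/orP; right; apply/eqP; apply: entP; rewrite -?gg ?g00 ?g01 ?g10 ?m00 ?m01 ?m10 ?m11.
case/orP=> /eqP ->; first exact: group1.
apply/centerP; split=> // h _; apply: entP; rewrite !entM ?m00 ?m01 ?m10 ?m11.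
all: by rewrite ?mulr0 ?mul0r ?addr0 ?add0r ?mulrN1 ?mulN1r.
Qed.

Lemma card_PSL2 : odd #|F| -> (2 * #|PSL2 F| = #|F| * #|F|.-1 * #|F|.+1)%N.
Proof.
move=> oddF; rewrite -card_SL2 card_quotient ?gFnorm //.
by rewrite -(Lagrange (center_sub (SL2 F))) card_SL2_center.
Qed.

(** The pair in SL_2 is transported twice: through the quotient by the centre, which lies in the
    Borel subgroup, and along the isomorphism. *)
Lemma isog_PSL2_borel_pair (gT : finGroupType) (A : {group gT}) :
  (A \isog PSL2 F)%g -> exists B P : {group gT}, borel_pair #|F| A B P.
Proof.
rewrite isog_sym => /isogP[f injf fA].
have F0 : (0 < #|F|)%N := ltnW (finNzRing_gt1 _).
have bpQ := morphim_borel_pair (f := coset_morphism 'Z(SL2 F)%g) F0 (gFnorm _ _) _ SL2_borel_pair.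
have {bpQ} := bpQ ltac:(by rewrite ker_coset subIset // SL2_center_borel orbT).
move/(morphim_borel_pair (f := f) F0 (subxx _)) => bp.
have {bp} := bp ltac:(by rewrite (trivgP injf) subIset // sub1G orbT).
have <- : (f @* PSL2 F)%G = A by apply: group_inj.
by move=> bp; do 2 eexists; apply: bp.
Qed.

Lemma isog_PSL2_has_borel_constituent p (gT : finGroupType) (A : {group gT}) :
  odd #|F| -> p \in [pchar F] ->
  (A \isog PSL2 F)%g -> has_borel_constituent p #|F|.+1 #|F| A.
Proof.
move=> oddF pF isoA; have [B [P bp]] := isog_PSL2_borel_pair isoA.
apply: (borel_pair_has_borel_constituent (finNzRing_gt1 F) bp).
have [nsPB sBA oP _ _] := bp; have sPA := subset_trans (normal_sub nsPB) sBA.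
have pnat_q : p.-nat #|F|.
  by rewrite -cardsT; apply: abelem_pgroup (fin_ring_pchar_abelem pF).
have pp := pcharf_prime pF.
have p_dvd : (p %| #|F|)%N.
  have [n qn] := p_natP pnat_q; rewrite qn dvdn_exp //.
  by move: (finNzRing_gt1 F); rewrite qn; case: n {qn}.
rewrite /pHall sPA /pgroup oP pnat_q /= p'natE //.
(* To see that P is Sylow: p divides q, hence neither q - 1 nor q + 1, so it cannot divide the index
   of P. *)
have q_eq : (2 * #|A : P|%g = #|F|.-1 * #|F|.+1)%N.
  apply/eqP; rewrite -(eqn_pmul2l (ltnW (finNzRing_gt1 F))) [X in _ == X]mulnA -card_PSL2 //.
  by rewrite -(card_isog isoA) -(Lagrange sPA) oP mulnCA.
apply/negP => pi; have : (p %| #|F|.-1 * #|F|.+1)%N by rewrite -q_eq dvdn_mull.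
have p1 : (p %| 1)%N = false by rewrite dvdn1 gtn_eqF ?prime_gt1.
rewrite Euclid_dvdM // => /orP[p_q|]; last by rewrite -addn1 dvdn_addr ?p1.
by move: p_dvd; rewrite -(prednK (ltnW (finNzRing_gt1 F))) -addn1 dvdn_addr ?p1.
Qed.

End SL2.

(** * The gap between |G| and its squared character degrees *)

Lemma irr1_gap_square (F : finFieldType) (k : nat) (gT : finGroupType)
    (G N : {group gT}) (Ns : 'I_k -> {group gT}) (i : Iirr G) (n : nat) :
  odd #|F| -> (5 <= #|F|)%N -> (0 < k)%N -> (N <| G)%g ->
  \big[dprod/1%g]_(i < k) Ns i = N ->
  (forall i, (Ns i \isog PSL2 F)%g) ->
  (#|F| ^ k <= #|G : N|%g)%N -> 'chi_i 1%g = n%:R ->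
  (n ^ 2 + n < #|G|)%N /\ (n ^ 3 < (#|G| - n - n ^ 2) ^ 2)%N.
Proof.
move=> oddF F5 k0 nsNG defN isoN; set q := #|F| in F5 *; set m := #|G : N|%g => mk ni.
have [p _ pF] := finPcharP F.
have hN : has_borel_constituent p (q.+1 ^ k) (q ^ k) N.
  by apply: has_borel_constituent_bigdprod defN _ => j; apply: isog_PSL2_has_borel_constituent.
have oN : #|N| = (#|PSL2 F| ^ k)%N.
  rewrite -(bigdprod_card defN) -[in RHS](card_ord k) -prod_nat_const.
  by apply: eq_bigr => j _; apply: card_isog.
have -> : #|G| = (m * #|N|)%N by rewrite mulnC Lagrange ?normal_sub.
have q3 : (q ^ 1 <= q ^ k)%N by rewrite leq_exp2l //; lia.
have oA := card_PSL2 oddF; rewrite -/q in oA.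
have two_k : (2 <= 2 ^ k)%N by rewrite -[X in (X <= _)%N]expn1 leq_exp2l.
have [nX|nR] := irr1_sqr_alternative nsNG hN ni.
  (* The Steinberg orbit: as q - 1 >= 4, twice q(q + 1) is at most |PSL_2(q)|, and k > 0 lets the
     single factor 2 be absorbed in 2^k. *)
  apply: (large_gap_of_half nX).
    rewrite mulnCA leq_mul2l; apply/orP; right; rewrite -expnMn oN.
    apply: leq_trans (_ : (2 * (q.+1 * q)) ^ k <= _)%N.
      by rewrite (expnMn 2) leq_mul2r two_k orbT.
    rewrite leq_exp2r // -(@leq_pmul2l 2) // oA.
    rewrite [leqLHS]mulnA (mulnAC q) (mulnC q q.+1) [leqLHS]mulnC.
    by rewrite leq_mul2l; apply/orP; right; lia.
  (* 30 is the value of (q + 1)q at q = 5. *)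
  apply: (@leq_mul 1 30); first by apply: leq_trans mk; rewrite expn_gt0; lia.
  apply: (@leq_mul 6 5); last by lia.
  by apply: (@leq_trans (q.+1 ^ 1)); rewrite ?leq_exp2l //; lia.
(* Any other orbit, with r = q^k: here 2|N| <= (2|PSL_2(q)|)^k = (q(q^2 - 1))^k <= r^3. *)
apply: large_gap_of_square nR => //; first by lia.
rewrite oN; apply: leq_trans (_ : (2 * #|PSL2 F|) ^ k <= _)%N.
  by rewrite expnMn leq_mul2r two_k orbT.
rewrite -expnM (mulnC k) expnM leq_exp2r // oA.
by case: (q) F5 => // q' _; rewrite !expnS expn0 /=; nia.
Qed.

Local Close Scope ring_scope.
Unset Implicit Arguments. Set Printing Implicit Defensive.

Theorem theorem6p1 (F : finFieldType) (k : nat) (gT : finGroupType)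
    (G N : {group gT}) (Ns : 'I_k -> {group gT}) :
  odd #|F| -> 5 <= #|F| ->
  (N <| G)%g -> minnormal N G ->
  \big[dprod/1%g]_(i < k) Ns i = N ->
  (forall i, (Ns i \isog PSL2 F)%g) ->
  #|F| ^ k <= #|(G / N)%g| ->
  let b := bmax G in
  let e := ((#|G|%:R / b) - b)%R in
  (sqrtC b + 1 < e)%R /\ (#|G|%:R < e ^+ 4 - e ^+ 3)%R.
Proof.
move=> oddF F5 nsNG minN defN isoN; rewrite card_quotient ?normal_norm // => mk b e.
(* An empty product would make N trivial, which a minimal normal subgroup is not. *)
have k0 : 0 < k.
  case: k Ns defN {isoN mk} => // Ns; rewrite big_ord0 => N1.
  by case/mingroupp/andP: minN; rewrite -N1 eqxx.
have [i bi] := bmax_attained G.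
have /natrP[n ni] := Cnat_irr1 i.
have n0 : 0 < n by rewrite lt0n -(pnatr_eq0 algC) -ni irr1_neq0.
have [g2 g3] := irr1_gap_square oddF F5 k0 nsNG defN isoN mk ni.
by have := excess_bounds n0 g2 g3; rewrite /e /b bi ni.
Qed.
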